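(* Let $U=[\alpha,\beta]\times[\gamma,\delta]\subset\mathbb{R}^2$, and let $a\colon[\alpha,\beta]\to\mathbb{R}^d$, $b\colon[\gamma,\delta]\to\mathbb{R}^d$, $\sigma\colon[\alpha,\beta]\to\mathbb{R}$ be smooth functions. Any regular cone-cylinder net $$f(u,v)=a(u)+\sigma(u)b(v),\qquad (u,v)\in U,$$ is deformable. For $\sigma(u)>0$, it is embedded into the one-parameter family $$f^+(u,v,t):=\underbrace{a(\alpha)+\int_\alpha^u\frac{a'(w)\sigma(w)\,dw}{\sqrt{t+\sigma(w)^2}}}_{a(u,t)}+\underbrace{\sqrt{t+\sigma(u)^2}}_{\sigma(u,t)}\,b(v),\qquad t\in[0,1],\ (u,v)\in U,$$ of cone-cylinder nets which are related to each other by area-preserving Combescure transformations.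
   Context: A (smooth) net $f\colon U\to\mathbb{R}^d$ is regular if $f_u(u,v)\nparallel f_v(u,v)$ for each $(u,v)\in U$ (i.e. $f_u,f_v$ are linearly independent). It is a conjugate net if the mixed partial derivative $f_{uv}$ at each point is parallel to the tangent plane. A smooth cone-cylinder net is one that possesses a parameterization of the form $f(u,v)=a(u)+\sigma(u)b(v)$ with smooth $a,b,\sigma$; such a net is a conjugate net. Two conjugate nets $f,f^+\colon U\to\mathbb{R}^d$ are parallel, or Combescure transforms of each other, if $f_u(u,v)\parallel f^+_u(u,v)$ and $f_v(u,v)\parallel f^+_v(u,v)$ for each $(u,v)\in U$. A Combescure transform $f^+$ of $f$ is area-preserving if $$\langle f_u,f_u\rangle\langle f_v,f_v\rangle-\langle f_u,f_v\rangle^2=\langle f^+_u,f^+_u\rangle\langle f^+_v,f^+_v\rangle-\langle f^+_u,f^+_v\rangle^2$$ at each point of $U$. Two conjugate nets $f,f^+\colon U\to\mathbb{R}^d$ are congruent if $f^+=g\circ f$ for some isometry $g\colon\mathbb{R}^d\to\mathbb{R}^d$. A conjugate net $f(u,v)$ is deformable if it belongs to a continuous family of non-congruent area-preserving Combescure transforms $f^+(u,v,t)$, $t\in[0,1]$. *)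

(* Defs.v *)
From mathcomp Require Import all_boot all_order all_algebra.
From mathcomp Require Import all_classical all_reals all_analysis.

Set Implicit Arguments.
Unset Strict Implicit.
Unset Printing Implicit Defensive.

Import Order.TTheory GRing.Theory Num.Theory.
Import numFieldNormedType.Exports.

Local Open Scope classical_set_scope.
Local Open Scope ring_scope.

(* The library derivative [f^`()] is two-sided, hence depends on values of f
   outside of a closed interval at its endpoints.  The derivatives below are
   relative to a set A: the difference quotient is restricted to A, so that
   they are one-sided at the endpoints when A = [alpha, beta]. *)
Section derivative_in.
Variables (R : realType) (V : normedModType R).
Implicit Types (A : set R) (f : R -> V) (x : R).

Definition diff_quotient_in A f x : set_system V :=
  (y - x)^-1 *: (f y - f x) @[y --> within A x^'].

Definition derivable_in A f x : Prop := cvg (diff_quotient_in A f x).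

Definition derive_in A f x : V := lim (diff_quotient_in A f x).

Definition smooth_on A f : Prop :=
  forall (n : nat) x, A x -> derivable_in A (iter n (derive_in A) f) x.

End derivative_in.

(* R^d is 'rV[R]_d; the library norm on matrices is the sup norm, so the
   Euclidean structure is defined separately. *)
Section euclidean.
Variables (R : realType) (d : nat).
Implicit Types x y : 'rV[R]_d.

Definition dot x y : R := \sum_(i < d) x 0 i * y 0 i.

Definition edist x y : R := Num.sqrt (dot (x - y) (x - y)).

Definition isometry (g : 'rV[R]_d -> 'rV[R]_d) : Prop :=
  forall x y, edist (g x) (g y) = edist x y.

(* linear dependence; in particular 0 is parallel to every vector *)
Definition parallel x y : bool := ~~ free [:: x; y].

End euclidean.

(* A net U -> R^d is represented by a total function on R * R, of which only
   the values on U are used. *)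
Section nets.
Variables (R : realType) (d : nat).
Local Notation V := 'rV[R]_d.
Local Notation net := (R * R -> V).
Implicit Types (U : set (R * R)) (f g : net) (F : R -> net).

Definition net_u U f : net :=
  fun p => derive_in [set u | U (u, p.2)] (fun u => f (u, p.2)) p.1.

Definition net_v U f : net :=
  fun p => derive_in [set v | U (p.1, v)] (fun v => f (p.1, v)) p.2.

Definition derivable_net U f (p : R * R) : Prop :=
  derivable_in [set u | U (u, p.2)] (fun u => f (u, p.2)) p.1 /\
  derivable_in [set v | U (p.1, v)] (fun v => f (p.1, v)) p.2.

(* true stands for d/du and false for d/dv *)
Definition net_partial U (w : seq bool) f : net :=
  foldr (fun (du : bool) g => if du then net_u U g else net_v U g) f w.

Definition smooth_net U f : Prop :=
  forall w : seq bool,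
    (forall p, U p -> derivable_net U (net_partial U w f) p) /\
    {within U, continuous (net_partial U w f)}.

Definition regular_net U f : Prop :=
  forall p, U p -> ~~ parallel (net_u U f p) (net_v U f p).

Definition conjugate_net U f : Prop :=
  smooth_net U f /\
  forall p, U p ->
    net_v U (net_u U f) p \in <<[:: net_u U f p; net_v U f p]>>%VS.

Definition combescure U f g : Prop :=
  [/\ conjugate_net U f, conjugate_net U g &
      forall p, U p -> parallel (net_u U f p) (net_u U g p) /\
                       parallel (net_v U f p) (net_v U g p)].

Definition area2 U f (p : R * R) : R :=
  dot (net_u U f p) (net_u U f p) * dot (net_v U f p) (net_v U f p)
  - dot (net_u U f p) (net_v U f p) ^+ 2.

Definition area_preserving_combescure U f g : Prop :=
  combescure U f g /\ forall p, U p -> area2 U f p = area2 U g p.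

Definition congruent U f g : Prop :=
  exists2 h : V -> V, isometry h & forall p, U p -> g p = h (f p).

Definition deformation U f F : Prop :=
  [/\ exists2 t, t \in `[0, 1] & (forall p, U p -> F t p = f p),
      {within [set q : R * (R * R) | q.1 \in `[0, 1] /\ U q.2],
        continuous (fun q => F q.1 q.2)},
      forall t, t \in `[0, 1] -> area_preserving_combescure U f (F t) &
      forall s t, s \in `[0, 1] -> t \in `[0, 1] -> s != t ->
        ~ congruent U (F s) (F t)].

Definition deformable U f : Prop := exists F, deformation U f F.

End nets.

Section cone_cylinder.
Variables (R : realType) (d : nat).
Local Notation V := 'rV[R]_d.
Implicit Types (I J : set R) (a b : R -> V) (sigma : R -> R).

Definition cone_cylinder_net a sigma b : R * R -> V :=
  fun p => a p.1 + sigma p.1 *: b p.2.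

Definition is_cone_cylinder I J (f : R * R -> V) : Prop :=
  exists a b sigma,
    [/\ smooth_on I a, smooth_on J b, smooth_on I sigma &
        forall p, (I `*` J) p -> f p = cone_cylinder_net a sigma b p].

Definition sigma_t sigma (t u : R) : R := Num.sqrt (t + sigma u ^+ 2).

Definition a_t (alpha beta : R) a sigma (t u : R) : V :=
  a alpha +
  \row_(i < d) \int[lebesgue_measure]_(w in `[alpha, u])
     (derive_in `[alpha, beta] a w 0 i * sigma w
      / Num.sqrt (t + sigma w ^+ 2)).

Definition cone_cylinder_family (alpha beta : R) a sigma b (t : R) :
    R * R -> V :=
  cone_cylinder_net (a_t alpha beta a sigma t) (sigma_t sigma t) b.

End cone_cylinder.

(* Main.v *)
Require Import Defs.
From mathcomp Require Import all_boot all_order all_algebra.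
From mathcomp Require Import all_classical all_reals all_analysis.
From mathcomp Require Import ring.
Import Order.TTheory GRing.Theory Num.Theory.
Import numFieldNormedType.Exports.
Local Open Scope classical_set_scope.
Local Open Scope ring_scope.
Set Implicit Arguments.
Unset Strict Implicit.
Unset Printing Implicit Defensive.

(* Put s_t = sqrt (t + sigma^2).  Differentiating the integral gives
   f+_u = (sigma / s_t) f_u, and f+_v = (s_t / sigma) f_v, so the partial
   derivatives stay parallel and the area element, invariant under
   (f_u, f_v) |-> (c f_u, f_v / c), is preserved.  All nets involved are
   smooth because the class of cone-cylinder nets is closed under both partial
   derivatives.  An isometry between f+(., s) and f+(., t) would preserve the
   distances s_t(alpha) |b(v) - b(gamma)| along u = alpha; as b is not constant
   this forces s = t.  Regularity excludes zeros of sigma, hence sigma has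
   constant sign, and the negative case reduces to the positive one because
   a + sigma b = a + (- sigma) (- b). *)

(** * Derivatives relative to a set *)

Section derivative_in.
Variables (R : realType) (A : set R).
(** No point of [A] is isolated in [A]. Limits of restricted difference quotients are then unique,
    so [derive_in] can be read off from any such limit. *)
Hypothesis properA : forall x, A x -> ProperFilter (within A x^').
Implicit Types (V : normedModType R).

Local Instance within_dnbhs_filter x : Filter (within A x^').
Proof. by apply: within_filter; apply: dnbhs_filter. Qed.

Lemma cvg_derivable_in V (f : R -> V) x (l : V) :
  diff_quotient_in A f x --> l -> derivable_in A f x.
Proof. by move=> fl; apply/cvg_ex; exists l. Qed.

Lemma cvg_derive_inE V (f : R -> V) x (l : V) : A x ->
  diff_quotient_in A f x --> l -> derive_in A f x = l.
Proof.
by move=> /properA Ax fl; apply: cvg_lim => //; apply: norm_hausdorff.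
Qed.

Lemma diff_quotient_in_ext V (f g : R -> V) x (l : V) : A x ->
  {in A, f =1 g} ->
  diff_quotient_in A f x --> l -> diff_quotient_in A g x --> l.
Proof.
move=> Ax fg fl; apply: cvg_trans fl.
by apply: fmap_within_eq => y Ay; rewrite !fg// inE.
Qed.

Lemma near_within_dnbhs_neq x : \forall y \near within A x^', y != x.
Proof. exact: cvg_within (nbhs_dnbhs_neq x). Qed.

Lemma cvg_within_dnbhs_id x : y @[y --> within A x^'] --> x.
Proof. by apply: cvg_within_filter; apply: cvg_within. Qed.

(** For [y != x], [f y] is [f x] plus [y - x] times the difference quotient, and that product tends
    to [0 *: l]. *)
Lemma diff_quotient_in_continuous V (f : R -> V) x (l : V) :
  diff_quotient_in A f x --> l -> f y @[y --> within A x^'] --> f x.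
Proof.
move=> df.
have hy : (y - x) @[y --> within A x^'] --> (0 : R).
  by rewrite -(subrr x); apply: cvgB (@cvg_within_dnbhs_id x) (cvg_cst _).
have fy : f x + (y - x) *: ((y - x)^-1 *: (f y - f x))
    @[y --> within A x^'] --> f x.
  by rewrite -[X in _ --> X]addr0 -(scale0r l);
    apply: cvgD (cvg_cst _) (cvgZ hy df).
apply: cvg_trans fy; apply: near_eq_cvg.
apply: filterS (@near_within_dnbhs_neq x) => y yx.
by rewrite /= scalerA divff ?scale1r ?subrKC// subr_eq0.
Qed.

Lemma derivable_in_cvg V (f : R -> V) x : derivable_in A f x ->
  f y @[y --> within A (nbhs x)] --> f x.
Proof.
move=> /diff_quotient_in_continuous fx B Bfx.
have := fx _ Bfx; rewrite /= /nbhs/= /within/= !nearE /= /dnbhs /within /= => H.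
(* The punctured filter says nothing about [y = x]; there [f x] lies in [B] because [B] is a
   neighbourhood of it. *)
apply: filterS H => y /= H Ay; have [->|yx] := eqVneq y x; last exact: H.
exact: nbhs_singleton.
Qed.

Lemma diff_quotient_inD V (f g : R -> V) x (l m : V) :
  diff_quotient_in A f x --> l -> diff_quotient_in A g x --> m ->
  diff_quotient_in A (fun y => f y + g y) x --> l + m.
Proof.
move=> fl gm; apply: cvg_trans (cvgD fl gm); apply: near_eq_cvg.
by apply: nearW => y; rewrite !fctE -scalerDr opprD addrACA.
Qed.

(** Product rule, from the splitting [(s y - s x) *: f y + s x *: (f y - f x)] and the continuity of
    [f] at [x] along [A]. *)
Lemma diff_quotient_inZ V (s : R -> R) (f : R -> V) x (k : R) (l : V) :
  diff_quotient_in A s x --> k -> diff_quotient_in A f x --> l ->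
  diff_quotient_in A (fun y => s y *: f y) x --> k *: f x + s x *: l.
Proof.
move=> sk fl.
have fx := diff_quotient_in_continuous fl.
apply: cvg_trans (cvgD (cvgZ sk fx) (cvgZ (cvg_cst (s x)) fl)).
apply: near_eq_cvg; apply: nearW => y.
rewrite !fctE. rewrite -[X in X *: f y]/((y - x)^-1 * (s y - s x)) -scalerA.
rewrite [s x *: (_ *: _)]scalerA [s x * _]mulrC -scalerA -scalerDr.
by congr (_ *: _); rewrite scalerBl scalerBr subrKA.
Qed.

Lemma diff_quotient_in_cst V (c : V) x :
  diff_quotient_in A (fun=> c) x --> (0 : V).
Proof.
rewrite /diff_quotient_in; under eq_fun do rewrite subrr scaler0.
exact: cvg_cst.
Qed.

(** Rationalisation: the quotient of [sqrt h] is that of [h] divided by [sqrt (h y) + sqrt (h x)],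
    wherever [h y > 0], hence for [y] near [x]. *)
Lemma diff_quotient_in_sqrt (h : R -> R) x (l : R) : 0 < h x ->
  diff_quotient_in A h x --> l ->
  diff_quotient_in A (fun y => Num.sqrt (h y) : R) x -->
    l / (2 * Num.sqrt (h x)).
Proof.
move=> hx hl.
have ch : h y @[y --> within A x^'] --> h x.
  exact: (@diff_quotient_in_continuous R h x l hl).
have cq : Num.sqrt (h y) @[y --> within A x^'] --> Num.sqrt (h x).
  by apply: continuous_cvg => //; apply: sqrt_continuous.
have sx : 0 < Num.sqrt (h x) by rewrite sqrtr_gt0.
have sx0 : Num.sqrt (h x) + Num.sqrt (h x) != 0 by rewrite gt_eqF// addr_gt0.
rewrite [2 * _]mulr_natl mulr2n.
apply: cvg_trans (cvgM hl (cvgV sx0 (cvgD cq (cvg_cst (Num.sqrt (h x)))))).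
apply: near_eq_cvg.
have hpos : \forall y \near within A x^', 0 < h y.
  exact: cvgr_gt ch _ hx.
apply: filterS hpos => y hy /=.
have sy : 0 < Num.sqrt (h y) by rewrite sqrtr_gt0.
have -> : h y - h x =
    (Num.sqrt (h y) - Num.sqrt (h x)) * (Num.sqrt (h y) + Num.sqrt (h x)).
  by rewrite -subr_sqr !sqr_sqrtr// ltW.
by rewrite fctE /GRing.scale/= mulrA mulfK// gt_eqF// addr_gt0.
Qed.

(** The quotient of [1 / q] is minus that of [q] divided by [q y * q x], for [y] so near [x] that
    [q y] does not vanish. *)
Lemma diff_quotient_inV (q : R -> R) x (l : R) : q x != 0 ->
  diff_quotient_in A q x --> l ->
  diff_quotient_in A (fun y => (q y)^-1 : R) x --> - l / q x ^+ 2.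
Proof.
move=> qx ql.
have cq : q y @[y --> within A x^'] --> q x.
  exact: (@diff_quotient_in_continuous R q x l ql).
rewrite expr2.
apply: cvg_trans (cvgM (cvgN ql)
  (cvgV (mulf_neq0 qx qx) (cvgM cq (cvg_cst (q x))))).
apply: near_eq_cvg.
have q0 : \forall y \near within A x^', q y != 0.
  exact: cvgr_neq0 cq qx.
apply: filterS q0 => y qy /=.
rewrite !fctE /GRing.scale/=; move: (y - x)^-1 => d; field.
by rewrite qx.
Qed.

(* Differentiability to order n, recursive in the derivative: unlike the
   iterates in [smooth_on], it lends itself to inductions in which the function
   changes, such as the product rule. *)
Fixpoint nsmooth_on V (n : nat) (f : R -> V) : Prop :=
  if n is m.+1 then
    (forall x, A x -> derivable_in A f x) /\ nsmooth_on m (derive_in A f)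
  else True.

(** [nsmooth_on] passes to the derivative of [f] first, whereas [iter] adds new derivatives on the
    outside; [iterSr] reconciles the two orders. *)
Lemma smooth_onP V (f : R -> V) : smooth_on A f <-> forall n, nsmooth_on n f.
Proof.
split=> [sf n|sf n].
  elim: n f sf => //= n IHn f sf; split=> [x|]; first exact: sf 0%N x.
  by apply: IHn => m x; have := sf m.+1 x; rewrite iterSr.
elim: n f sf => [|n IHn] f sf x Ax; first by have [+ _] := sf 1%N; exact.
rewrite iterSr; apply: IHn => // m; by have [] := sf m.+1.
Qed.

Lemma smooth_on_derivable V (f : R -> V) x :
  smooth_on A f -> A x -> derivable_in A f x.
Proof. by move=> sf; exact: sf 0%N x. Qed.

Lemma smooth_on_derive V (f : R -> V) :
  smooth_on A f -> smooth_on A (derive_in A f).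
Proof. by move=> sf n x; have := sf n.+1 x; rewrite iterSr. Qed.

Lemma nsmooth_on_eq V n (f g : R -> V) :
  {in A, f =1 g} -> nsmooth_on n f -> nsmooth_on n g.
Proof.
elim: n f g => //= n IHn f g fg [df sf]; split=> [x Ax|].
  exact: cvg_derivable_in (diff_quotient_in_ext Ax fg (df x Ax)).
apply: IHn sf => x; rewrite inE => Ax; apply/esym/cvg_derive_inE => //.
exact: (diff_quotient_in_ext Ax fg (df x Ax)).
Qed.

(** Lets an explicit formula [f'], valid only on [A], stand in for [derive_in A f] in inductions on
    the order. *)
Lemma nsmooth_on_deriv V n (f f' : R -> V) :
  (forall x, A x -> diff_quotient_in A f x --> f' x) ->
  nsmooth_on n f' -> nsmooth_on n.+1 f.
Proof.
move=> ff' sf'; split=> [x Ax|]; first exact: cvg_derivable_in (ff' x Ax).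
apply: nsmooth_on_eq sf' => x; rewrite inE => Ax.
by apply/esym/cvg_derive_inE => //; exact: ff'.
Qed.

Lemma nsmooth_onW V n (f : R -> V) : nsmooth_on n.+1 f -> nsmooth_on n f.
Proof.
elim: n f => //= n IHn f [df sf]; split=> //; exact: IHn.
Qed.

Lemma nsmooth_onD V n (f g : R -> V) :
  nsmooth_on n f -> nsmooth_on n g -> nsmooth_on n (fun x => f x + g x).
Proof.
elim: n f g => // n IHn f g [df sf] [dg sg].
apply: nsmooth_on_deriv (IHn _ _ sf sg) => x Ax.
by apply: diff_quotient_inD; [exact: df|exact: dg].
Qed.

Lemma nsmooth_onZ V n (s : R -> R) (f : R -> V) :
  nsmooth_on n s -> nsmooth_on n f -> nsmooth_on n (fun x => s x *: f x).
Proof.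
elim: n s f => // n IHn s f [ds ss] [df sf].
(* Each term of the product rule keeps one factor undifferentiated, so the induction hypothesis also
   needs the factors themselves at order [n]. *)
have sW : nsmooth_on n s by apply: nsmooth_onW; split.
have fW : nsmooth_on n f by apply: nsmooth_onW; split.
apply: nsmooth_on_deriv (nsmooth_onD (IHn _ _ ss fW) (IHn _ _ sW sf)) => x Ax.
by apply: diff_quotient_inZ; [exact: ds|exact: df].
Qed.

Lemma nsmooth_on_cst V n (c : V) : nsmooth_on n (fun=> c).
Proof.
elim: n c => // n IHn c; apply: nsmooth_on_deriv (IHn 0) => x _.
exact: diff_quotient_in_cst.
Qed.

Lemma nsmooth_onM n (s r : R -> R) :
  nsmooth_on n s -> nsmooth_on n r -> nsmooth_on n (fun x => s x * r x : R).
Proof. exact: nsmooth_onZ. Qed.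

(* The derivative of [r := 1 / sqrt h] is [- h' / 2 * r ^ 3], so [r] inherits
   one more order of smoothness than it already has. *)
Lemma nsmooth_on_sqrtV n (h : R -> R) : (forall x, A x -> 0 < h x) ->
  nsmooth_on n h -> nsmooth_on n (fun x => (Num.sqrt (h x))^-1 : R).
Proof.
move=> hpos; elim: n => // n IHn sh; set r : R -> R := fun x => _.
have sr : nsmooth_on n r by apply: IHn; exact: nsmooth_onW.
have [dh sh'] := sh.
pose r' := fun x => (- 2^-1 * derive_in A h x * r x) * (r x * r x) : R.
apply: (@nsmooth_on_deriv R n r r').
  move=> x Ax; have hx := hpos x Ax.
  have sx : 0 < Num.sqrt (h x) by rewrite sqrtr_gt0.
  have -> : r' x =
      - (derive_in A h x / (2 * Num.sqrt (h x))) / Num.sqrt (h x) ^+ 2.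
    by rewrite /r' /r; field; rewrite gt_eqF.
  apply: (@diff_quotient_inV (fun x => Num.sqrt (h x))); first by rewrite gt_eqF.
  by apply: diff_quotient_in_sqrt => //; exact: dh.
apply: nsmooth_onM; last exact: nsmooth_onM.
by apply: nsmooth_onM => //; apply: nsmooth_onM => //; exact: nsmooth_on_cst.
Qed.

Lemma smooth_on_deriv V (f f' : R -> V) :
  (forall x, A x -> diff_quotient_in A f x --> f' x) ->
  smooth_on A f' -> smooth_on A f.
Proof.
move=> ff' /smooth_onP sf'; apply/smooth_onP => -[//|n].
exact: nsmooth_on_deriv ff' (sf' n).
Qed.

Lemma smooth_on_eq V (f g : R -> V) :
  {in A, f =1 g} -> smooth_on A f -> smooth_on A g.
Proof.
move=> fg /smooth_onP sf; apply/smooth_onP => n.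
exact: nsmooth_on_eq fg (sf n).
Qed.

Lemma smooth_onD V (f g : R -> V) :
  smooth_on A f -> smooth_on A g -> smooth_on A (fun x => f x + g x).
Proof.
move=> /smooth_onP sf /smooth_onP sg; apply/smooth_onP => n.
exact: nsmooth_onD.
Qed.

Lemma smooth_onZ V (s : R -> R) (f : R -> V) :
  smooth_on A s -> smooth_on A f -> smooth_on A (fun x => s x *: f x).
Proof.
move=> /smooth_onP ss /smooth_onP sf; apply/smooth_onP => n.
exact: nsmooth_onZ.
Qed.

Lemma smooth_on_cst V (c : V) : smooth_on A (fun=> c).
Proof. by apply/smooth_onP => n; exact: nsmooth_on_cst. Qed.

Lemma smooth_onN V (f : R -> V) :
  smooth_on A f -> smooth_on A (fun x => - f x).
Proof.
move=> sf; have := smooth_onZ (@smooth_on_cst R (-1)) sf.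
by apply: smooth_on_eq => x _; rewrite scaleN1r.
Qed.

Lemma smooth_on_sqrtV (h : R -> R) : (forall x, A x -> 0 < h x) ->
  smooth_on A h -> smooth_on A (fun x => (Num.sqrt (h x))^-1 : R).
Proof.
by move=> hpos /smooth_onP sh; apply/smooth_onP => n; exact: nsmooth_on_sqrtV.
Qed.

Lemma smooth_on_cvg V (f : R -> V) x :
  smooth_on A f -> A x -> f y @[y --> within A (nbhs x)] --> f x.
Proof. by move=> sf Ax; apply: derivable_in_cvg; exact: smooth_on_derivable. Qed.

Lemma smooth_on_continuous V (f : R -> V) :
  smooth_on A f -> {within A, continuous f}.
Proof.
by move=> sf; apply/subspace_continuousP => x; exact: smooth_on_cvg.
Qed.

End derivative_in.

(** * The fundamental theorem of calculus up to the endpoints *)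

Section interval.
Variable R : realType.
Implicit Types (alpha beta x : R) (V : normedModType R).

(** A point left of [beta] is approached from the right inside the interval; [beta] itself is
    approached from the left. *)
Lemma within_itv_dnbhs_proper alpha beta : alpha < beta ->
  forall x, `[alpha, beta]%classic x -> ProperFilter (within `[alpha, beta] x^').
Proof.
move=> ab x /=; rewrite in_itv/= => /andP[ax xb].
apply: Build_ProperFilter_ex => P.
rewrite /within/= /dnbhs/within/= => xP.
have /nbhs_ballP[e /= e0 He] := xP.
have [xb'|bx] := ltP x beta.
  (* Half the radius keeps [y] in the ball, and the minimum with [beta] keeps it in the interval. *)
  pose y := Num.min beta (x + e / 2).
  have xy : x < y by rewrite lt_min xb'/= ltrDl divr_gt0.
  exists y; apply: He.
  - rewrite /ball/= ltr_distlC; apply/andP; split; last first.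
      by rewrite gt_min [x + e / 2 < _]ltrD2l ltr_pdivrMr// ltr_pMr// ltr1n orbT.
    by rewrite (lt_trans _ xy)// gtrBl.
  - by rewrite gt_eqF.
  - by rewrite in_itv/= (le_trans ax (ltW xy))/= ge_min lexx.
pose y := Num.max alpha (x - e / 2).
have yx : y < x by rewrite gt_max (lt_le_trans ab bx)/= gtrBl divr_gt0.
exists y; apply: He.
- rewrite /ball/= ltr_distlC; apply/andP; split; last first.
    by rewrite (lt_trans yx)// ltrDl.
  by rewrite lt_max ltrD2l ltrN2 ltr_pdivrMr// ltr_pMr// ltr1n orbT.
- by rewrite lt_eqF.
- by rewrite in_itv/= le_max lexx/= (le_trans (ltW yx)).
Qed.

Lemma derivable_diff_quotient (F : R -> R) x : derivable F x 1 ->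
  (y - x)^-1 *: (F y - F x) @[y --> x^'] --> 'D_1 F x.
Proof.
move=> dF.
have yx : y - x @[y --> x^'] --> 0^'.
  move=> P /= [e /= e0 He]; exists e => //= y yxe ynx; apply: He => //=.
    by rewrite sub0r normrN distrC.
  by rewrite subr_eq0.
apply: cvg_trans (cvg_comp _ _ yx dF); apply: near_eq_cvg.
by apply: nearW => y /=; rewrite scaler1 subrK.
Qed.

(** Near an interior point the restriction to [A] is no constraint, and the substitution [y = h + x]
    yields the two-sided quotient. *)
Lemma diff_quotient_in_interior V (A : set R) (F : R -> V) x (l : V) :
  nbhs x A -> diff_quotient_in A F x --> l -> is_derive x 1 F l.
Proof.
move=> xA Fl.
suff H : h^-1 *: ((F \o shift x) (h *: 1) - F x) @[h --> 0^'] --> l.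
  apply: DeriveDef; first by apply/cvg_ex; exists l.
  by apply: cvg_lim => //; exact: norm_hausdorff.
have hx : h + x @[h --> 0^'] --> within A x^'.
  move=> P xP; have {}xP : \forall y \near x, y != x -> A y -> P y by exact: xP.
  have /nbhs_ballP[e /= e0 He] : nbhs x (A `&` (fun y => y != x -> A y -> P y)).
    exact: filterI.
  exists e => //= h; rewrite /ball_/= sub0r normrN => he h0.
  have [|Ah] := He (h + x).
    by rewrite /ball/= opprD addrCA subrr addr0 normrN.
  by apply => //; rewrite -subr_eq0 addrK.
apply: cvg_trans (cvg_comp _ _ hx Fl); apply: near_eq_cvg.
by apply: nearW => y /=; rewrite scaler1 addrK.
Qed.

End interval.

Section integral.
Variables (R : realType) (alpha beta : R).
Hypothesis ab : alpha < beta.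
Local Notation I := (`[alpha, beta]%classic : set R).
Local Notation mu := (@lebesgue_measure R).

(* Extending the integrand by constants beyond the endpoints makes the
   two-sided fundamental theorem of calculus applicable on the closed
   interval. *)
Let clamp (w : R) : R := Num.max alpha (Num.min w beta).

Let clamp_in w : I (clamp w).
Proof. by rewrite /= in_itv/= le_max lexx/= ge_max ge_min lexx orbT ltW. Qed.

Let clamp_id w : I w -> clamp w = w.
Proof. by rewrite /= in_itv/= => /andP[aw wb]; rewrite /clamp min_l// max_r. Qed.

Let continuous_clamp (g : R -> R) :
  {within I, continuous g} -> continuous (g \o clamp).
Proof.
move=> /subspace_continuousP cg w.
(* [clamp] is continuous with all values in [I], so continuity of [g] relative to [I] is enough for
   the composite. *)
apply: (@cvg_comp _ _ _ clamp g _ (within I (nbhs (clamp w)))); last exact: cg.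
move=> P /= cP; have cP' : nbhs (clamp w) (fun y => I y -> P y) by exact: cP.
have cc : {for w, continuous (cst alpha \max (id \min cst beta))}.
  apply: (@continuous_max R R (cst alpha)); first exact: cvg_cst.
  by apply: (@continuous_min R R id); [exact: cvg_id|exact: cvg_cst].
have {}cc : clamp y @[y --> w] --> clamp w by exact: cc.
have H : \forall y \near w, I (clamp y) -> P (clamp y) by exact: cc _ cP'.
by apply: filterS H => y /(_ (clamp_in y)).
Qed.

Lemma diff_quotient_in_integral (g : R -> R) x :
  {within I, continuous g} -> I x ->
  diff_quotient_in I (fun u => \int[mu]_(w in `[alpha, u]) g w) x --> g x.
Proof.
move=> cg Ix; have cgc := continuous_clamp cg.
(* Starting at [alpha - 1], and integrating up to [beta + 1] below, makes every point of [I]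
   interior to the domain of integration. *)
pose G u := \int[mu]_(w in `[alpha - 1, u]) (g \o clamp) w.
have [ax xb] : alpha <= x /\ x <= beta.
  by move: Ix; rewrite /= in_itv/= => /andP[].
have intg : mu.-integrable `[alpha - 1, beta + 1] (EFin \o (g \o clamp)).
  apply: continuous_compact_integrable; first exact: segment_compact.
  exact: continuous_subspaceT.
have [dG G'] : derivable G x 1 /\ G^`()%classic x = (g \o clamp) x.
  apply: continuous_FTC1_closed intg _ (cgc x).
    by rewrite (le_lt_trans xb)// ltrDl.
  by rewrite (lt_le_trans _ ax)// gtrBl.
(* On [I] the clamp is the identity, so the integral from [alpha] differs from [G] by the constant
   [G alpha] only, which the quotient does not see. *)
have GE u : I u -> \int[mu]_(w in `[alpha, u]) g w = G u - G alpha.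
  move=> Iu; have [au ub] : alpha <= u /\ u <= beta.
    by move: Iu; rewrite /= in_itv/= => /andP[].
  rewrite /G (@Rintegral_itvB _ (g \o clamp)) ?bnd_simp//; last 2 first.
  - apply: integrableS intg => //.
    by apply: subset_itvl; rewrite bnd_simp (le_trans ub)// lerDl.
  - by rewrite gerBl.
  rewrite Rintegral_itv_obnd_cbnd; last first.
    apply: integrableS intg => //.
    by apply: subset_itv; rewrite bnd_simp ?gerBl// (le_trans ub)// lerDl.
  apply: eq_Rintegral => w; rewrite inE/= in_itv/= => /andP[aw wu].
  by rewrite /= clamp_id//= in_itv/= aw (le_trans wu).
apply: (@diff_quotient_in_ext R _ R (fun u => G u - G alpha)) => //.
  by move=> u; rewrite inE => Iu; rewrite GE.
have Gx : (y - x)^-1 *: (G y - G x) @[y --> x^'] --> g x.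
  have := derivable_diff_quotient dG.
  by rewrite -derive1E G' /= clamp_id.
rewrite /diff_quotient_in.
under eq_fun do rewrite opprB subrKA.
by apply: cvg_within_filter; exact: Gx.
Qed.

Lemma integral_derive_in (F : R -> R) u : smooth_on I F -> I u ->
  \int[mu]_(w in `[alpha, u]) derive_in I F w = F u - F alpha.
Proof.
move=> sF; rewrite /= in_itv/= => /andP[au ub].
have properI := @within_itv_dnbhs_proper R alpha beta ab.
have subI : `[alpha, u]%classic `<=` I by apply: subset_itvl; rewrite bnd_simp.
(* The degenerate interval is set aside, since the fundamental theorem is applied with
   [alpha < u]. *)
have [->|au'] := eqVneq u alpha; first by rewrite set_itv1 Rintegral_set1 subrr.
have {au'}au : alpha < u by rewrite lt_neqAle eq_sym au'.
have cF : {within `[alpha, u], continuous F}.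
  exact: continuous_subspaceW subI (smooth_on_continuous sF).
have dF x : x \in `]alpha, u[ -> is_derive x 1 F (derive_in I F x).
  rewrite in_itv/= => /andP[ax xu].
  apply: (@diff_quotient_in_interior R R I).
    have : nbhs x `]alpha, u[%classic.
      by apply: near_in_itvoo; rewrite in_itv/= ax.
    by apply: filterS; apply: subset_trans subI; exact: subset_itv_oo_cc.
  apply: (smooth_on_derivable sF).
  by rewrite /= in_itv/= (ltW ax) (le_trans (ltW xu)).
rewrite /Rintegral (@continuous_FTC2 _ _ F) ?EFinN//.
- apply: continuous_subspaceW subI _; apply: smooth_on_continuous.
  exact: smooth_on_derive.
- have [_ Fa Fu] := (continuous_within_itvP F au).1 cF.
  by split=> // x /dF dFx; exact: ex_derive.
- by move=> x /dF dFx; rewrite derive1E derive_val.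
Qed.

(** The bound is uniform in [u], so that in the joint continuity of the family the upper limit may
    move together with the parameter. *)
Lemma integral_dist_le (g h : R -> R) e u :
  {within I, continuous g} -> {within I, continuous h} ->
  (forall w, I w -> `|g w - h w| <= e) -> I u ->
  `|\int[mu]_(w in `[alpha, u]) g w - \int[mu]_(w in `[alpha, u]) h w| <=
    e * (beta - alpha).
Proof.
move=> cg ch ghe Iu; have [au ub] : alpha <= u /\ u <= beta.
  by move: Iu; rewrite /= in_itv/= => /andP[].
have e0 : 0 <= e.
  by apply: le_trans (ghe alpha _) => //=; rewrite in_itv/= lexx ltW.
have subI : `[alpha, u]%classic `<=` I by apply: subset_itvl; rewrite bnd_simp.
have int k : {within I, continuous k} -> mu.-integrable `[alpha, u] (EFin \o k).
  move=> ck; apply: continuous_compact_integrable; first exact: segment_compact.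
  exact: continuous_subspaceW subI ck.
have igh : mu.-integrable `[alpha, u] (EFin \o (fun w => g w - h w)).
  by apply: int => w; apply: cvgB; [exact: cg|exact: ch].
rewrite -RintegralB//; [|exact: int|exact: int].
apply: le_trans (le_normr_Rintegral _ igh) _ => //.
apply: (@le_trans _ _ (\int[mu]_(w in `[alpha, u]) cst e w)).
  apply: le_Rintegral => //.
  - exact: (integrable_norm igh).
  - by apply: int => w; exact: cvg_cst.
  - by move=> w /subI Iw; exact: ghe.
rewrite Rintegral_cst//= lebesgue_measure_itv/= lte_fin.
(* The measure of [[alpha, u]] is given by cases: [u - alpha] if [alpha < u], and 0 otherwise. *)
case: ifPn => _ /=; last by rewrite mulr0 mulr_ge0// subr_ge0 ltW.
by rewrite ler_wpM2l// lerD2r.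
Qed.

End integral.

(** * Coordinatewise limits and derivatives of row vectors *)

Section row_vectors.
Variables (R : realType) (d : nat).

Lemma cvg_row (T : Type) (F : set_system T) (FF : Filter F)
    (f : T -> 'rV[R]_d) (l : 'rV[R]_d) :
  (forall i, f y 0 i @[y --> F] --> l 0 i) -> f y @[y --> F] --> l.
Proof.
move=> fl; apply/cvg_ballP => e e0.
have : \forall y \near F, forall i, ball (l 0 i) e (f y 0 i).
  by apply: filter_forall => i; have /cvg_ballP := fl i; apply.
by apply: filterS => y fy; split=> // i j; rewrite !ord1.
Qed.

Lemma diff_quotient_in_coord (A : set R) (f : R -> 'rV[R]_d) x
    (l : 'rV[R]_d) i :
  diff_quotient_in A f x --> l ->
  diff_quotient_in A (fun y => f y 0 i) x --> l 0 i.
Proof.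
move=> fl.
apply: cvg_trans (cvg_comp _ _ fl (@coord_continuous R 1 d 0 i l)).
by apply: near_eq_cvg; apply: nearW => y /=; rewrite !mxE.
Qed.

Lemma diff_quotient_in_row (A : set R) (f : 'I_d -> R -> R) x (l : 'rV[R]_d) :
  (forall i, diff_quotient_in A (f i) x --> l 0 i) ->
  diff_quotient_in A (fun y => \row_i f i y) x --> l.
Proof.
move=> fl; apply: cvg_row => i; apply: cvg_trans (fl i).
by apply: near_eq_cvg; apply: nearW => y /=; rewrite !mxE.
Qed.

Lemma smooth_on_coord (A : set R) (f : R -> 'rV[R]_d) i :
  (forall x, A x -> ProperFilter (within A x^')) ->
  smooth_on A f -> smooth_on A (fun x => f x 0 i : R).
Proof.
move=> properA /smooth_onP sf; apply/smooth_onP => n.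
elim: n f {sf}(sf n) => // n IHn f [df sf].
apply: nsmooth_on_deriv (IHn _ sf) => // x Ax.
exact: diff_quotient_in_coord (df x Ax).
Qed.

End row_vectors.

(** * Cone-cylinder nets *)

Section nets.
Variables (R : realType) (d : nat) (I J : set R).
Hypothesis properI : forall x, I x -> ProperFilter (within I x^').
Hypothesis properJ : forall x, J x -> ProperFilter (within J x^').
Local Notation V := 'rV[R]_d.
Local Notation U := (I `*` J).
Implicit Types (a b : R -> V) (sigma : R -> R) (f g : R * R -> V) (p : R * R).

Lemma slice_u p : U p -> [set u | U (u, p.2)] = I.
Proof. by move=> [_ Jp]; apply/seteqP; split=> u //= []. Qed.

Lemma slice_v p : U p -> [set v | U (p.1, v)] = J.
Proof. by move=> [Ip _]; apply/seteqP; split=> u //= []. Qed.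

Lemma eq_net_slice_u f g p : {in U, f =1 g} -> U p ->
  {in I, (fun u => f (u, p.2)) =1 (fun u => g (u, p.2))}.
Proof. by move=> fg [_ Jp] u; rewrite inE => Iu; apply: fg; rewrite inE. Qed.

Lemma eq_net_slice_v f g p : {in U, f =1 g} -> U p ->
  {in J, (fun v => f (p.1, v)) =1 (fun v => g (p.1, v))}.
Proof. by move=> fg [Ip _] u; rewrite inE => Iu; apply: fg; rewrite inE. Qed.

Section cone_cylinder.
Variables (a b : R -> V) (sigma : R -> R) (f : R * R -> V).
Hypotheses (sa : smooth_on I a) (sb : smooth_on J b) (ss : smooth_on I sigma).
Hypothesis fE : {in U, cone_cylinder_net a sigma b =1 f}.

Lemma diff_quotient_cone_cylinder_u p : U p ->
  diff_quotient_in [set u | U (u, p.2)] (fun u => f (u, p.2)) p.1 -->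
    derive_in I a p.1 + derive_in I sigma p.1 *: b p.2.
Proof.
move=> Up; have [Ip _] := Up; rewrite slice_u//.
apply: (diff_quotient_in_ext Ip (eq_net_slice_u fE Up)).
rewrite -[_ *: b p.2]addr0 -(scaler0 _ (sigma p.1)).
apply: diff_quotient_inD; first exact: smooth_on_derivable.
apply: diff_quotient_inZ; first exact: smooth_on_derivable.
exact: (@diff_quotient_in_cst R I V (b p.2)).
Qed.

Lemma diff_quotient_cone_cylinder_v p : U p ->
  diff_quotient_in [set v | U (p.1, v)] (fun v => f (p.1, v)) p.2 -->
    sigma p.1 *: derive_in J b p.2.
Proof.
move=> Up; have [_ Jp] := Up; rewrite slice_v//.
apply: (diff_quotient_in_ext Jp (eq_net_slice_v fE Up)).
(* The zeros are the derivatives in [v] of the constants [a p.1] and [sigma p.1], giving the shape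
   of the sum and product rules. *)
have -> : sigma p.1 *: derive_in J b p.2 =
    0 + (0 *: b p.2 + sigma p.1 *: derive_in J b p.2) by rewrite scale0r !add0r.
apply: diff_quotient_inD; first exact: (@diff_quotient_in_cst R J V (a p.1)).
apply: diff_quotient_inZ; last exact: smooth_on_derivable.
exact: (@diff_quotient_in_cst R J R (sigma p.1)).
Qed.

Lemma net_u_cone_cylinder p : U p ->
  net_u U f p = derive_in I a p.1 + derive_in I sigma p.1 *: b p.2.
Proof.
move=> Up; rewrite /net_u; apply: cvg_lim; first exact: norm_hausdorff.
  by rewrite slice_u//; apply: properI; case: Up.
exact: diff_quotient_cone_cylinder_u.
Qed.

Lemma net_v_cone_cylinder p : U p ->
  net_v U f p = sigma p.1 *: derive_in J b p.2.
Proof.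
move=> Up; rewrite /net_v; apply: cvg_lim; first exact: norm_hausdorff.
  by rewrite slice_v//; apply: properJ; case: Up.
exact: diff_quotient_cone_cylinder_v.
Qed.

End cone_cylinder.

Lemma is_cone_cylinder_net_u f :
  is_cone_cylinder I J f -> is_cone_cylinder I J (net_u U f).
Proof.
move=> [a [b [s [sa sb ss fE]]]].
exists (derive_in I a), b, (derive_in I s).
split; [exact: smooth_on_derive|exact: sb|exact: smooth_on_derive|].
move=> p Up; apply: (net_u_cone_cylinder sa ss) Up => q.
by rewrite inE => /fE ->.
Qed.

Lemma is_cone_cylinder_net_v f :
  is_cone_cylinder I J f -> is_cone_cylinder I J (net_v U f).
Proof.
move=> [a [b [s [sa sb ss fE]]]].
exists (fun=> 0), (derive_in J b), s.
split; [exact: smooth_on_cst|exact: smooth_on_derive|exact: ss|].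
move=> p Up; rewrite /cone_cylinder_net add0r.
by apply: (net_v_cone_cylinder sb _ Up) => q; rewrite inE => /fE ->.
Qed.

Lemma is_cone_cylinder_derivable f p :
  is_cone_cylinder I J f -> U p -> derivable_net U f p.
Proof.
move=> [a [b [s [sa sb ss fE]]]] Up.
have {}fE : {in U, cone_cylinder_net a s b =1 f}.
  by move=> q; rewrite inE => /fE.
have H1 := diff_quotient_cone_cylinder_u sa ss fE Up.
have H2 := diff_quotient_cone_cylinder_v sb fE Up.
by split; [exact: cvg_derivable_in H1|exact: cvg_derivable_in H2].
Qed.

Lemma cvg_fst_within p : q.1 @[q --> within U (nbhs p)] --> within I (nbhs p.1).
Proof.
move=> P PI; have {}PI : \forall x \near p.1, I x -> P x by exact: PI.
have H : \forall q \near p, I q.1 -> P q.1 by exact: cvg_fst PI.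
by apply: filterS H => q H [/= Iq _]; exact: H.
Qed.

Lemma cvg_snd_within p : q.2 @[q --> within U (nbhs p)] --> within J (nbhs p.2).
Proof.
move=> P PI; have {}PI : \forall x \near p.2, J x -> P x by exact: PI.
have H : \forall q \near p, J q.2 -> P q.2 by exact: cvg_snd PI.
by apply: filterS H => q H [/= _ Iq]; exact: H.
Qed.

Lemma is_cone_cylinder_continuous f :
  is_cone_cylinder I J f -> {within U, continuous f}.
Proof.
move=> [a [b [s [sa sb ss fE]]]]; apply/subspace_continuousP => p Up.
have [Ip Jp] := Up.
have : cone_cylinder_net a s b q @[q --> within U (nbhs p)] --> f p.
  rewrite fE//; apply: cvgD.
    exact: cvg_comp (@cvg_fst_within p) (smooth_on_cvg sa Ip).
  apply: cvgZ; first exact: cvg_comp (@cvg_fst_within p) (smooth_on_cvg ss Ip).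
  exact: cvg_comp (@cvg_snd_within p) (smooth_on_cvg sb Jp).
by apply: cvg_trans; apply: fmap_within_eq => q; rewrite inE => /fE.
Qed.

(** Induction on the word [w]: every iterated partial is again a cone-cylinder net, so derivability
    and continuity are needed for such nets only. *)
Lemma is_cone_cylinder_smooth f : is_cone_cylinder I J f -> smooth_net U f.
Proof.
move=> cf w; have : is_cone_cylinder I J (net_partial U w f).
  elim: w => //= -[] w IHw.
    exact: is_cone_cylinder_net_u.
  exact: is_cone_cylinder_net_v.
move=> cw; split=> [p Up|]; first exact: is_cone_cylinder_derivable.
exact: is_cone_cylinder_continuous.
Qed.

(** Here [f_uv = sigma' b'] and [f_v = sigma b'], so as [sigma] does not vanish, [f_uv] is a
    multiple of [f_v]. *)
Lemma cone_cylinder_conjugate a b sigma :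
  smooth_on I a -> smooth_on J b -> smooth_on I sigma ->
  (forall u, I u -> sigma u != 0) ->
  conjugate_net U (cone_cylinder_net a sigma b).
Proof.
move=> sa sb ss s0; set f := cone_cylinder_net a sigma b.
have fE : {in U, cone_cylinder_net a sigma b =1 f} by [].
split; first by apply: is_cone_cylinder_smooth; exists a, b, sigma.
move=> p Up; have [Ip Jp] := Up.
have -> : net_v U (net_u U f) p = derive_in I sigma p.1 *: derive_in J b p.2.
  apply: (@net_v_cone_cylinder (derive_in I a) b (derive_in I sigma)) => // q.
  by rewrite inE => Uq; rewrite (net_u_cone_cylinder sa ss fE).
have -> : derive_in I sigma p.1 *: derive_in J b p.2 =
    (derive_in I sigma p.1 / sigma p.1) *: net_v U f p.
  by rewrite (net_v_cone_cylinder sb fE)// scalerA divfK// s0.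
by rewrite memvZ// memv_span// !inE eqxx orbT.
Qed.

End nets.

(** * Dot products, parallelism and the area element *)

Section euclidean.
Variables (R : realType) (d : nat).
Implicit Types (x y : 'rV[R]_d) (k l : R).

Lemma dotZZ k l x y : dot (k *: x) (l *: y) = k * l * dot x y.
Proof.
by rewrite /dot mulr_sumr; apply: eq_bigr => i _; rewrite !mxE mulrACA.
Qed.

Lemma dot_ge0 x : 0 <= dot x x.
Proof. by apply: sumr_ge0 => i _; rewrite -expr2 sqr_ge0. Qed.

Lemma dot_eq0 x : dot x x = 0 -> x = 0.
Proof.
move=> x0; apply/rowP => i; rewrite mxE; apply/eqP; rewrite -sqrf_eq0 expr2.
by rewrite (psumr_eq0P _ x0)// => j _; rewrite -expr2 sqr_ge0.
Qed.

Lemma parallelZ k x : k != 0 -> parallel x (k *: x).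
Proof.
move=> k0; rewrite /parallel free_cons negb_and negbK; apply/orP; left.
rewrite -{1}(scale1r x) -(mulVf k0) -scalerA memvZ// memv_span// inE//.
Qed.

Lemma free2_neq0 x y : ~~ parallel x y -> y != 0.
Proof. by rewrite negbK free_cons seq1_free => /andP[]. Qed.

(* The area element is invariant under [(f_u, f_v) |-> (c f_u, f_v / c)]. *)
Lemma area_preserving_scale (U : set (R * R)) (f g : R * R -> 'rV[R]_d)
    (c : R * R -> R) :
  conjugate_net U f -> conjugate_net U g -> (forall p, U p -> c p != 0) ->
  (forall p, U p -> net_u U g p = c p *: net_u U f p) ->
  (forall p, U p -> net_v U g p = (c p)^-1 *: net_v U f p) ->
  area_preserving_combescure U f g.
Proof.
move=> cf cg c0 gu gv; split.
  split=> // p Up; rewrite (gu p Up) (gv p Up); have cp := c0 p Up.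
  by split; apply: parallelZ; rewrite ?invr_eq0.
move=> p Up; rewrite /area2 (gu p Up) (gv p Up).
move: (c p) (c0 p Up) (net_u U f p) (net_v U f p) => k k0 x y.
by rewrite !dotZZ; field.
Qed.

End euclidean.

(** With [p] and [q] the two roots, [1/p - 1/q = (q^2 - p^2) / (p q (p + q))]; both roots are at
    least [x], so the denominator is at least [x ^ 3]. *)
Lemma sqrtV_dist_le (R : realType) (x s t : R) : 0 < x -> 0 <= s -> 0 <= t ->
  `|(Num.sqrt (t + x ^+ 2))^-1 - (Num.sqrt (s + x ^+ 2))^-1| <=
    `|t - s| / x ^+ 3.
Proof.
move=> x0 s0 t0; set p := Num.sqrt (t + _); set q := Num.sqrt (s + _).
have x20 : 0 <= x ^+ 2 by rewrite sqr_ge0.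
have ge r : 0 <= r -> x <= Num.sqrt (r + x ^+ 2).
  by move=> r0; rewrite -{1}(gtr0_norm x0) -sqrtr_sqr ler_sqrt ?lerDr ?addr_ge0.
have xp : x <= p := ge _ t0; have xq : x <= q := ge _ s0.
have p0 : 0 < p := lt_le_trans x0 xp; have q0 : 0 < q := lt_le_trans x0 xq.
have -> : p^-1 - q^-1 = (s - t) / (p * q * (p + q)).
  have -> : s - t = q ^+ 2 - p ^+ 2.
    by rewrite !sqr_sqrtr ?addr_ge0// opprD addrACA subrr addr0.
  by field; rewrite !gt_eqF// addr_gt0.
rewrite normrM distrC ler_wpM2l// gtr0_norm ?invr_gt0 ?mulr_gt0 ?addr_gt0//.
rewrite lef_pV2 ?posrE ?exprn_gt0 ?mulr_gt0 ?addr_gt0//.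
have x0' := ltW x0; have xpq : x <= p + q by rewrite (le_trans xp)// lerDl ltW.
by rewrite exprS expr2 mulrA !ler_pM ?mulr_ge0.
Qed.

(** * The area-preserving family *)

Section family.
Variables (R : realType) (d : nat) (alpha beta gamma delta : R).
Variables (a b : R -> 'rV[R]_d) (sigma : R -> R).
Implicit Types (s t u : R) (p : R * R).
Hypotheses (ab : alpha < beta) (cd : gamma < delta).
Local Notation I := (`[alpha, beta]%classic : set R).
Local Notation J := (`[gamma, delta]%classic : set R).
Local Notation U := (I `*` J).
Hypotheses (sa : smooth_on I a) (sb : smooth_on J b) (ss : smooth_on I sigma).
Local Notation mu := (@lebesgue_measure R).
Local Notation f := (cone_cylinder_net a sigma b).
Local Notation fplus := (cone_cylinder_family alpha beta a sigma b).
Local Notation k := (fun (i : 'I_d) (t w : R) =>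
  derive_in I a w 0 i * sigma w / Num.sqrt (t + sigma w ^+ 2) : R).

Let properI := @within_itv_dnbhs_proper R alpha beta ab.
Let properJ := @within_itv_dnbhs_proper R gamma delta cd.

(** Regularity forbids [f_v = sigma b'] to vanish, and the row [v = gamma] yields both claims. The
    second certifies later that [b] is not constant. *)
Lemma regular_cone_cylinder : regular_net U f ->
  (forall u, I u -> sigma u != 0) /\ derive_in J b gamma != 0.
Proof.
have Ia : I alpha by rewrite /= in_itv/= lexx ltW.
have Jc : J gamma by rewrite /= in_itv/= lexx ltW.
have fE : {in U, f =1 f} by [].
move=> reg; have fv u : I u -> (sigma u != 0) && (derive_in J b gamma != 0).
  move=> Iu; have Up : U (u, gamma) by split.
  have := free2_neq0 (reg _ Up).
  by rewrite (net_v_cone_cylinder properJ sb fE)// scaler_eq0 negb_or.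
by split=> [u /fv/andP[]|]; last have /andP[] := fv _ Ia.
Qed.

Hypothesis sigma_gt0 : forall u, I u -> 0 < sigma u.

Let radicand_gt0 t u : 0 <= t -> I u -> 0 < t + sigma u ^+ 2.
Proof. by move=> t0 Iu; rewrite ltr_wpDl// exprn_gt0// sigma_gt0. Qed.

Lemma sigma_t_gt0 t u : 0 <= t -> I u -> 0 < sigma_t sigma t u.
Proof. by move=> t0 Iu; rewrite sqrtr_gt0 radicand_gt0. Qed.

Let smooth_on_radicand t : smooth_on I (fun u => t + sigma u ^+ 2 : R).
Proof.
apply: (smooth_onD properI); first exact: (smooth_on_cst properI).
exact: (@smooth_onZ R I properI R sigma sigma ss ss).
Qed.

Lemma diff_quotient_sigma_t t u : 0 <= t -> I u ->
  diff_quotient_in I (sigma_t sigma t) u -->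
    sigma u / sigma_t sigma t u * derive_in I sigma u.
Proof.
move=> t0 Iu; set s' := derive_in I sigma u.
have ds : diff_quotient_in I sigma u --> s' by exact: smooth_on_derivable ss Iu.
have dh : diff_quotient_in I (fun u => t + sigma u ^+ 2 : R) u -->
    0 + (s' * sigma u + sigma u * s').
  apply: (@diff_quotient_inD R I R (fun=> t) (fun u => sigma u ^+ 2)).
    exact: (@diff_quotient_in_cst R I R t).
  exact: (@diff_quotient_inZ R I R sigma sigma).
have -> : sigma u / sigma_t sigma t u * s' =
    (0 + (s' * sigma u + sigma u * s')) / (2 * Num.sqrt (t + sigma u ^+ 2)).
  rewrite /sigma_t; field; rewrite gt_eqF//.
  exact: sigma_t_gt0.
by apply: diff_quotient_in_sqrt => //; exact: radicand_gt0.
Qed.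

(** Follows from [sqrt h = h * (1 / sqrt h)], which reduces the root to its already treated
    reciprocal. *)
Lemma smooth_on_sigma_t t : 0 <= t -> smooth_on I (sigma_t sigma t).
Proof.
move=> t0; have sh := @smooth_on_radicand t.
have sr := smooth_on_sqrtV properI (fun u => @radicand_gt0 t u t0) sh.
apply: smooth_on_eq (smooth_onZ properI sh sr) => // u.
rewrite inE => Iu; rewrite /sigma_t.
rewrite -[X in X *: _]sqr_sqrtr ?ltW ?radicand_gt0//.
by rewrite /GRing.scale/= expr2 mulfK// gt_eqF// sigma_t_gt0.
Qed.

Let smooth_on_ratio t : 0 <= t ->
  smooth_on I (fun u => sigma u / sigma_t sigma t u : R).
Proof.
move=> t0; apply: (@smooth_onZ R I properI R sigma _ ss).
apply: (smooth_on_sqrtV properI); last exact: smooth_on_radicand.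
by move=> u; exact: radicand_gt0.
Qed.

Let smooth_on_integrand i t : 0 <= t -> smooth_on I (k i t).
Proof.
move=> t0; have sa' := smooth_on_coord (i := i) properI (smooth_on_derive sa).
apply: (@smooth_on_eq R I properI R
    (fun u => (sigma u / sigma_t sigma t u) *: derive_in I a u 0 i)).
  by move=> u _; rewrite /sigma_t /GRing.scale/= mulrC mulrA.
exact: (smooth_onZ properI (smooth_on_ratio t0)).
Qed.

Lemma diff_quotient_a_t t u : 0 <= t -> I u ->
  diff_quotient_in I (a_t alpha beta a sigma t) u -->
    (sigma u / sigma_t sigma t u) *: derive_in I a u.
Proof.
move=> t0 Iu; rewrite -[_ *: _]add0r.
apply: diff_quotient_inD; first exact: (@diff_quotient_in_cst R I _ (a alpha)).
apply: (@diff_quotient_in_row R d I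
    (fun i u => \int[mu]_(w in `[alpha, u]) k i t w)) => i.
have -> : ((sigma u / sigma_t sigma t u) *: derive_in I a u) 0 i = k i t u.
  by rewrite mxE /sigma_t mulrC mulrA.
apply: diff_quotient_in_integral => //.
by apply: smooth_on_continuous; exact: smooth_on_integrand.
Qed.

Lemma smooth_on_a_t t : 0 <= t -> smooth_on I (a_t alpha beta a sigma t).
Proof.
move=> t0; apply: (smooth_on_deriv properI (fun u => @diff_quotient_a_t t u t0)).
exact: (smooth_onZ properI (smooth_on_ratio t0) (smooth_on_derive sa)).
Qed.

(** The derivatives of [a_t] and [sigma_t] carry the same factor [sigma / sigma_t] relative to those
    of [a] and [sigma], so it can be pulled out of the sum. *)
Lemma net_u_family t p : 0 <= t -> U p ->
  net_u U (fplus t) p = (sigma p.1 / sigma_t sigma t p.1) *: net_u U f p.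
Proof.
move=> t0 Up; have [Ip _] := Up.
have fE : {in U, f =1 f} by [].
have FE : {in U, cone_cylinder_net (a_t alpha beta a sigma t)
    (sigma_t sigma t) b =1 fplus t} by [].
rewrite (net_u_cone_cylinder properI (smooth_on_a_t t0)
  (smooth_on_sigma_t t0) FE Up).
rewrite (net_u_cone_cylinder properI sa ss fE Up).
rewrite (cvg_derive_inE properI Ip (diff_quotient_a_t t0 Ip)).
rewrite (cvg_derive_inE properI Ip (diff_quotient_sigma_t t0 Ip)).
by rewrite scalerDr scalerA.
Qed.

Lemma net_v_family t p : 0 <= t -> U p ->
  net_v U (fplus t) p = (sigma p.1 / sigma_t sigma t p.1)^-1 *: net_v U f p.
Proof.
move=> t0 Up; have [Ip _] := Up.
have fE : {in U, f =1 f} by [].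
have FE : {in U, cone_cylinder_net (a_t alpha beta a sigma t)
    (sigma_t sigma t) b =1 fplus t} by [].
rewrite (net_v_cone_cylinder properJ sb FE Up).
rewrite (net_v_cone_cylinder properJ sb fE Up).
by rewrite scalerA invf_div divfK// gt_eqF// sigma_gt0.
Qed.

Lemma conjugate_family t : 0 <= t -> conjugate_net U (fplus t).
Proof.
move=> t0; apply: (cone_cylinder_conjugate properI properJ
  (smooth_on_a_t t0) sb (smooth_on_sigma_t t0)).
by move=> u Iu; rewrite gt_eqF// sigma_t_gt0.
Qed.

Lemma conjugate_cone_cylinder : conjugate_net U f.
Proof.
apply: (cone_cylinder_conjugate properI properJ sa sb ss) => u Iu.
by rewrite gt_eqF// sigma_gt0.
Qed.

Lemma family_area_preserving t : 0 <= t ->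
  area_preserving_combescure U f (fplus t).
Proof.
move=> t0; apply: (@area_preserving_scale _ _ _ _ _
    (fun p => sigma p.1 / sigma_t sigma t p.1)).
- exact: conjugate_cone_cylinder.
- exact: conjugate_family.
- by move=> p [Ip _]; rewrite gt_eqF// divr_gt0 ?sigma_gt0 ?sigma_t_gt0.
- by move=> p; exact: net_u_family.
- by move=> p; exact: net_v_family.
Qed.

Lemma family_area_preserving2 s t : 0 <= s -> 0 <= t ->
  area_preserving_combescure U (fplus s) (fplus t).
Proof.
(* The scaling factor is the quotient of [sigma / sigma_t] at [t] by the same expression at [s], the
   factors leading from [f] to the two nets. *)
move=> s0 t0; apply: (@area_preserving_scale _ _ _ _ _
    (fun p => sigma_t sigma s p.1 / sigma_t sigma t p.1)).
- exact: conjugate_family.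
- exact: conjugate_family.
- by move=> p [Ip _]; rewrite gt_eqF// divr_gt0 ?sigma_t_gt0.
- move=> p Up; rewrite !net_u_family// scalerA; congr (_ *: _).
  by have [Ip _] := Up; field; rewrite !gt_eqF ?sigma_t_gt0.
- move=> p Up; rewrite !net_v_family// scalerA; congr (_ *: _).
  by have [Ip _] := Up; field; rewrite !gt_eqF ?sigma_t_gt0 ?sigma_gt0.
Qed.

(** As [sigma > 0], [sqrt (sigma ^ 2)] is [sigma]; the integrand collapses to [a'], whose integral
    is [a u - a alpha]. *)
Lemma family0 p : U p -> fplus 0 p = f p.
Proof.
move=> [Ip _]; rewrite /cone_cylinder_family /cone_cylinder_net.
congr (_ + _); last first.
  by rewrite /sigma_t add0r sqrtr_sqr gtr0_norm// sigma_gt0.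
apply/rowP => i; rewrite !mxE.
rewrite (_ : \int[mu]_(w in _) _ = a p.1 0 i - a alpha 0 i) ?subrKC//.
rewrite -(integral_derive_in ab (smooth_on_coord (i := i) properI sa) Ip).
apply: eq_Rintegral => w; rewrite inE/= in_itv/= => /andP[aw wp].
have Iw : I w.
  rewrite /= in_itv/= aw (le_trans wp)//.
  by move: Ip; rewrite /= in_itv/= => /andP[].
rewrite add0r sqrtr_sqr gtr0_norm ?sigma_gt0// mulfK ?gt_eqF ?sigma_gt0//.
apply/esym/cvg_derive_inE => //; apply: diff_quotient_in_coord.
exact: smooth_on_derivable sa Iw.
Qed.

Lemma family_not_congruent s t : derive_in J b gamma != 0 ->
  0 <= s -> 0 <= t -> s != t -> ~ congruent U (fplus s) (fplus t).
Proof.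
move=> b0 s0 t0 st [h hiso hE].
have Ia : I alpha by rewrite /= in_itv/= lexx ltW.
have Jc : J gamma by rewrite /= in_itv/= lexx ltW.
(* The contradiction sought is a vanishing derivative of [b] at [gamma], obtained by showing [b]
   constant on [J]. *)
move/eqP: b0; apply; apply: (cvg_derive_inE properJ Jc).
apply: (@diff_quotient_in_ext R J _ (fun=> b gamma)) => //; last first.
  exact: (@diff_quotient_in_cst R J _ (b gamma)).
move=> v; rewrite inE => Jv; apply/esym/eqP; rewrite -subr_eq0.
apply/eqP/dot_eq0.
(* Both points lie on the curve [u = alpha], so the [a_t] terms cancel and only
   [sigma_t *: (b v - b gamma)] remains. *)
have distE r : Defs.edist (fplus r (alpha, v)) (fplus r (alpha, gamma)) =
    Num.sqrt (sigma_t sigma r alpha ^+ 2 *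
              dot (b v - b gamma) (b v - b gamma)).
  rewrite /Defs.edist /cone_cylinder_family /cone_cylinder_net/=.
  by rewrite opprD addrACA subrr add0r -scalerBr dotZZ expr2.
have := hiso (fplus s (alpha, v)) (fplus s (alpha, gamma)).
rewrite -!hE// !distE /sigma_t => /eqP.
rewrite eqr_sqrt ?mulr_ge0 ?sqrtr_ge0 ?dot_ge0//.
(* Since [sigma_t ^+ 2] is [t + sigma ^+ 2], equal distances say that [s - t] times the squared
   length of [b v - b gamma] is 0. *)
rewrite !sqr_sqrtr ?ltW ?radicand_gt0// -subr_eq0 -mulrBl.
rewrite opprD addrACA subrr addr0 mulf_eq0 subr_eq0.
by rewrite eq_sym (negbTE st) => /eqP.
Qed.

(** By [sqrtV_dist_le], [C] can be the maximum over the compact [I] of the continuous function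
    [|a'_i sigma| / sigma ^ 3], with [a'_i] a coordinate of [a']. *)
Let integrand_lipschitz i : exists C, forall s t w, 0 <= s -> 0 <= t -> I w ->
  `|k i t w - k i s w| <= C * `|t - s|.
Proof.
have sa' := smooth_on_coord (i := i) properI (smooth_on_derive sa).
have cF : {within I, continuous (fun w =>
    `|derive_in I a w 0 i * sigma w| / (sigma w * sigma w * sigma w))}.
  apply/subspace_continuousP => w Iw; have cs := smooth_on_cvg ss Iw.
  apply: cvgM.
    by apply: cvg_norm; apply: cvgM cs; exact: (smooth_on_cvg sa' Iw).
  apply: cvgV; first by rewrite !mulf_neq0// gt_eqF// sigma_gt0.
  exact: cvgM (cvgM cs cs) cs.
have [w0 _ w0max] := EVT_max (ltW ab) cF.
eexists => s t w s0 t0 Iw; rewrite -mulrBr normrM.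
have le_r := sqrtV_dist_le (sigma_gt0 Iw) s0 t0.
apply: le_trans (ler_wpM2l (normr_ge0 _) le_r) _.
rewrite mulrCA mulrC; apply: ler_wpM2r => //.
by rewrite !exprS expr0 mulr1 mulrA; exact: w0max.
Qed.

Local Notation D := [set q : R * (R * R) | q.1 \in `[0, 1] /\ U q.2].

Let cvg_time t0 p0 : q.1 @[q --> within D (nbhs (t0, p0))] --> t0.
Proof. by apply: cvg_within_filter; exact: cvg_fst. Qed.

Let cvg_point t0 p0 :
  q.2 @[q --> within D (nbhs (t0, p0))] --> within U (nbhs p0).
Proof.
move=> P PU; have {}PU : \forall x \near p0, U x -> P x by exact: PU.
have H : \forall q \near (t0, p0), U q.2 -> P q.2 by exact: cvg_snd PU.
by apply: filterS H => q H [/= _ Uq]; exact: H.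
Qed.

(** Coordinatewise, [K t u - K t0 u0] splits into [K t u - K t0 u], at most
    [C |t - t0| (beta - alpha)], and [K t0 u - K t0 u0], small by continuity in the upper limit. *)
Let cvg_a_t t0 p0 : D (t0, p0) ->
  a_t alpha beta a sigma q.1 q.2.1 @[q --> within D (nbhs (t0, p0))] -->
    a_t alpha beta a sigma t0 p0.1.
Proof.
move=> -[/= t01 Up0]; have [Iu0 _] := Up0.
have t0_ge0 : 0 <= t0 by move: t01; rewrite in_itv/= => /andP[].
have DP : \forall q \near within D (nbhs (t0, p0)), 0 <= q.1 /\ I q.2.1.
  suff : \forall q \near (t0, p0), D q -> 0 <= q.1 /\ I q.2.1 by [].
  by near=> q => -[/=]; rewrite in_itv/= => /andP[q0 _] [].
have c2 := cvg_comp _ _ (@cvg_point t0 p0) (@cvg_fst_within R I J p0).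
rewrite /a_t; apply: cvgD; first exact: cvg_cst.
apply: cvg_row => i; rewrite mxE; under eq_fun do rewrite mxE.
pose K t u := \int[mu]_(w in `[alpha, u]) k i t w.
have ck t : 0 <= t -> {within I, continuous (k i t)}.
  by move=> tge; apply: smooth_on_continuous; exact: smooth_on_integrand.
have cK : K t0 q.2.1 @[q --> within D (nbhs (t0, p0))] --> K t0 p0.1.
  apply: cvg_comp c2 _; apply: (@derivable_in_cvg R I R (K t0)).
  exact: cvg_derivable_in (diff_quotient_in_integral ab (ck _ t0_ge0) Iu0).
have [C HC] := integrand_lipschitz i.
have cd0 : K q.1 q.2.1 - K t0 q.2.1 @[q --> within D (nbhs (t0, p0))] --> 0.
  apply: norm_cvg0.
  apply: (@squeeze_cvgr _ _ _ _ (fun=> 0)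
      (fun q => C * `|q.1 - t0| * (beta - alpha))).
  - apply: filterS DP => q [q1 q2]; rewrite normr_ge0/=.
    by apply: integral_dist_le => //; [exact: ck|exact: ck|move=> w; exact: HC].
  - exact: cvg_cst.
  - have E : C * `|t0 - t0| * (beta - alpha) = 0.
      by rewrite subrr normr0 mulr0 mul0r.
    rewrite -[X in _ --> X]E.
    apply: cvgM; last exact: cvg_cst.
    apply: cvgM; first exact: cvg_cst.
    by apply: cvg_norm; apply: cvgB; [exact: cvg_time|exact: cvg_cst].
suff : K q.1 q.2.1 @[q --> within D (nbhs (t0, p0))] --> K t0 p0.1 by [].
rewrite -[X in _ --> X]add0r.
apply: cvg_trans (cvgD cd0 cK); apply: near_eq_cvg; apply: nearW => q.
by rewrite fctE subrK.
Unshelve. all: by end_near. Qed.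

Lemma family_continuous :
  {within [set q : R * (R * R) | q.1 \in `[0, 1] /\ U q.2],
    continuous (fun q => fplus q.1 q.2)}.
Proof.
apply/subspace_continuousP => -[t0 p0] Dp; have [_ [Iu0 Jv0]] := Dp.
have cs : sigma q.2.1 @[q --> within D (nbhs (t0, p0))] --> sigma p0.1.
  have := cvg_comp _ _ (@cvg_fst_within R I J p0) (smooth_on_cvg ss Iu0).
  exact: cvg_comp _ _ (@cvg_point t0 p0).
apply: cvgD; first exact: cvg_a_t.
apply: cvgZ; last first.
  have := cvg_comp _ _ (@cvg_snd_within R I J p0) (smooth_on_cvg sb Jv0).
  exact: cvg_comp _ _ (@cvg_point t0 p0).
apply: continuous_cvg; first exact: sqrt_continuous.
exact: cvgD (@cvg_time t0 p0) (cvgM cs cs).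
Qed.

Lemma family_deformation : derive_in J b gamma != 0 -> deformation U f fplus.
Proof.
have ge0 t : t \in `[0, 1] -> 0 <= t by rewrite in_itv/= => /andP[].
move=> b0; split.
- by exists 0; [rewrite in_itv/= lexx ler01|exact: family0].
- exact: family_continuous.
- by move=> t /ge0; exact: family_area_preserving.
- by move=> s t /ge0 s0 /ge0 t0; exact: family_not_congruent.
Qed.

Lemma family_is_cone_cylinder t : 0 <= t -> is_cone_cylinder I J (fplus t).
Proof.
move=> t0; exists (a_t alpha beta a sigma t), b, (sigma_t sigma t).
by split; [exact: smooth_on_a_t|exact: sb|exact: smooth_on_sigma_t|].
Qed.

End family.

(** * Constant sign of [sigma] and the main result *)

Lemma nonzero_constant_sign (R : realType) (alpha beta : R) (s : R -> R) :
  alpha < beta -> {within `[alpha, beta], continuous s} ->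
  (forall u, u \in `[alpha, beta] -> s u != 0) ->
  (forall u, u \in `[alpha, beta] -> 0 < s u) \/
  (forall u, u \in `[alpha, beta] -> s u < 0).
Proof.
move=> ab cs s0; have Ia : alpha \in `[alpha, beta] by rewrite in_itv/= lexx ltW.
(* If 0 lay between [s alpha] and [s u], the intermediate value theorem would give a zero; hence
   every [s u] has the sign of [s alpha]. *)
have noroot u : u \in `[alpha, beta] ->
    ~~ (Num.min (s alpha) (s u) <= 0 <= Num.max (s alpha) (s u)).
  rewrite in_itv/= => /andP[au ub]; apply/negP => H.
  have subI : `[alpha, u]%classic `<=` `[alpha, beta].
    by apply: subset_itvl; rewrite bnd_simp.
  have [c cu /eqP] := IVT au (continuous_subspaceW subI cs) H.
  by apply/negP/s0; exact: subI.
have [sa|sa|sa0] := ltgtP (s alpha) 0; last by have := s0 _ Ia; rewrite sa0 eqxx.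
  right=> u Iu; have := noroot u Iu; rewrite ge_min le_max (ltW sa)/= leNgt sa/=.
  by rewrite -ltNge.
left=> u Iu; have := noroot u Iu; rewrite ge_min le_max (ltW sa)/= andbT leNgt sa/=.
by rewrite -ltNge.
Qed.

Theorem proposition4p2 (R : realType) (d : nat) (alpha beta gamma delta : R)
    (a b : R -> 'rV[R]_d) (sigma : R -> R)
    (hab : alpha < beta) (hcd : gamma < delta)
    (ha : smooth_on `[alpha, beta] a)
    (hb : smooth_on `[gamma, delta] b)
    (hsigma : smooth_on `[alpha, beta] sigma)
    (hreg : regular_net (`[alpha, beta] `*` `[gamma, delta])
              (cone_cylinder_net a sigma b)) :
  let U := `[alpha, beta] `*` `[gamma, delta] in
  let f := cone_cylinder_net a sigma b in
  let fplus := cone_cylinder_family alpha beta a sigma b in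
  deformable U f /\
  ((forall u, u \in `[alpha, beta] -> 0 < sigma u) ->
   [/\ forall p, U p -> fplus 0 p = f p,
       forall t, t \in `[0, 1] ->
         is_cone_cylinder `[alpha, beta] `[gamma, delta] (fplus t),
       forall s t, s \in `[0, 1] -> t \in `[0, 1] ->
         area_preserving_combescure U (fplus s) (fplus t) &
       deformation U f fplus]).

Proof.
move=> U f fplus; split; last first.
  move=> sigma_gt0; have [_ b0] := regular_cone_cylinder hab hcd hb hreg.
  have ge0 t : t \in `[0, 1] -> 0 <= t by rewrite in_itv/= => /andP[].
  split.
  - exact: family0.
  - by move=> t /ge0; exact: family_is_cone_cylinder.
  - by move=> s t /ge0 s0 /ge0 t0; exact: family_area_preserving2.
  - exact: family_deformation.
have [s0 b0] := regular_cone_cylinder hab hcd hb hreg.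
have csigma := smooth_on_continuous hsigma.
have [sigma_gt0|sigma_lt0] := nonzero_constant_sign hab csigma s0.
  by exists fplus; exact: family_deformation.
have fN : f = cone_cylinder_net a (fun u => - sigma u) (fun v => - b v).
  by apply/funext => p; rewrite /f /cone_cylinder_net scaleNr scalerN opprK.
have hbN := smooth_onN (within_itv_dnbhs_proper hcd) hb.
have hsN := smooth_onN (within_itv_dnbhs_proper hab) hsigma.
have [_ bN0] : (forall u, u \in `[alpha, beta] -> - sigma u != 0) /\
    derive_in `[gamma, delta] (fun v => - b v) gamma != 0.
  by apply: (regular_cone_cylinder (a := a) hab hcd hbN); rewrite -fN.
(* For negative [sigma] the root [sqrt (sigma ^ 2)] is [- sigma], so the family is built from
   [- sigma] and [- b], whose net is again [f]. *)
exists (cone_cylinder_family alpha beta a (fun u => - sigma u) (fun v => - b v)).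
rewrite fN; apply: family_deformation => // u Iu.
by rewrite oppr_gt0; exact: sigma_lt0.
Qed.
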